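(* Let $I$ be a set, let $\tau\colon \mathbb{R}^I\to\mathbb{R}$ be a function and let $p\in[1,+\infty)$. The following conditions are equivalent. (1) $\tau$ preserves $p$-integrability. (2) $\tau$ is $\mathrm{Cyl}(\mathbb{R}^I)$-measurable and there exist a finite subset $J\subseteq I$ and nonnegative real numbers $(\lambda_j)_{j\in J}$ such that, for every $v\in\mathbb{R}^I$, $|\tau(v)|\leq\sum_{j\in J}\lambda_j|v_j|$.
   Context: The set $I$ may have any cardinality. $\mathrm{Cyl}(\mathbb{R}^I)$ is the smallest $\sigma$-algebra on $\mathbb{R}^I$ making every projection $\pi_i\colon\mathbb{R}^I\to\mathbb{R}$ ($i\in I$) measurable; $\mathbb{R}$ always carries its Borel $\sigma$-algebra. For a measure space $(\Omega,\mathcal{F},\mu)$ (with $\mu$ valued in $[0,+\infty]$), $\mathcal{L}^p(\mu)$ is the set of $\mathcal{F}$-measurable functions $f\colon\Omega\to\mathbb{R}$ with $\int_\Omega|f|^p\,d\mu<\infty$ (actual functions, not classes). For a family $(f_i)_{i\in I}$ of functions $\Omega\to\mathbb{R}$, $\tau((f_i)_{i\in I})\colon\Omega\to\mathbb{R}$ is the function $x\mapsto\tau((f_i(x))_{i\in I})$. $\tau$ preserves $p$-integrability over $(\Omega,\mathcal{F},\mu)$ if $\tau((f_i)_{i\in I})\in\mathcal{L}^p(\mu)$ for every family $(f_i)_{i\in I}$ of elements of $\mathcal{L}^p(\mu)$; $\tau$ preserves $p$-integrability if it does so over every measure space. *)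

(* Defs.v *)
From HB Require Import structures.
From mathcomp Require Import all_boot all_order all_algebra finmap.
From mathcomp Require Import all_classical all_reals all_analysis.

Set Implicit Arguments.
Unset Strict Implicit.
Unset Printing Implicit Defensive.

Import Order.TTheory GRing.Theory Num.Theory.
Import numFieldNormedType.Exports.

Local Open Scope classical_set_scope.
Local Open Scope ring_scope.

(* [R] carries its canonical Borel sigma-algebra here. *)
Definition proj_preimages (I : Type) (R : realType) : set_system (I -> R) :=
  \bigcup_(i in [set: I])
    preimage_set_system setT (fun v : I -> R => v i) measurable.

(* R^I as a measurable space: its measurable sets form
   Cyl(R^I) = <<s proj_preimages I R >>. *)
Notation cylType I R := (g_sigma_algebraType (@proj_preimages I R)).

(* [Lfun] requires the p-norm, i.e. the 1/p-th power of the integral of |f|^p,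
   to be finite; for finite p this is finiteness of the integral itself. *)
Lemma Lfun_powR d (T : measurableType d) (R : realType)
    (mu : {measure set T -> \bar R}) (p : R) (f : T -> R) : 1 <= p ->
  f \in Lfun mu p%:E <->
  measurable_fun setT f /\ (\int[mu]_x (`|f x| `^ p)%:E < +oo)%E.
Proof.
move=> p1; have p0 : p != 0 by rewrite gt_eqF// (lt_le_trans _ p1).
have I0 : (0 <= \int[mu]_x (`|f x| `^ p)%:E)%E.
  by apply: integral_ge0 => x _; rewrite lee_fin powR_ge0.
have NE : ('N[mu]_(p%:E)[EFin \o f] `^ p = \int[mu]_x (`|f x| `^ p)%:E)%E.
  by rewrite poweR_Lnorm.
split.
- move=> /andP[]; rewrite inE /= => mf; rewrite inE /= /finite_norm => Nf.
  by split; [exact: mf | rewrite -NE poweR_lty].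
- case=> mf intf; apply/andP; split; rewrite inE//=.
  rewrite /finite_norm unlock /Lnorm poweR_lty//.
Qed.

(* The library's measurable types are inhabited; over the empty measure space
   the condition holds trivially. *)
Definition preserves_integrability (I : Type) (R : realType)
    (tau : (I -> R) -> R) (p : R) : Prop :=
  forall (d : measure_display) (T : measurableType d)
         (mu : {measure set T -> \bar R}) (f : I -> T -> R),
    (forall i, f i \in Lfun mu p%:E) ->
    (fun x => tau (fun i => f i x)) \in Lfun mu p%:E.

(* Main.v *)
(* Integrability of the projections under the zero measure on R^I forces tau
   to be Cyl-measurable, hence to depend on a countable set C of coordinates.
   Let the finite sets J_n exhaust C.  If no bound of the required shape holds,
   pick v_n with sum_(j in J_n) 2^(n+1) |v_n j| < |tau v_n|, and set v_n j = 0
   for j outside C, which does not change tau v_n; for the measure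
   sum_n |tau v_n|^(-p) delta_n on nat, every function n |-> v_n j is
   p-integrable whereas n |-> tau v_n is not.  Conversely, tau (f_i)_i is
   dominated by the p-integrable function sum_(j in J) lambda_j |f_j|. *)
Require Import Defs.
From HB Require Import structures.
From mathcomp Require Import all_boot all_order all_algebra finmap.
From mathcomp Require Import all_classical all_reals all_analysis.
From mathcomp Require Import measurable_realfun.

Set Implicit Arguments.
Unset Strict Implicit.
Unset Printing Implicit Defensive.

Import Order.TTheory GRing.Theory Num.Theory.
Import numFieldNormedType.Exports.

Local Open Scope classical_set_scope.
Local Open Scope ring_scope.

Lemma measurable_proj_cyl (I : Type) (R : realType) (i : I) :
  measurable_fun [set: cylType I R] (fun v : cylType I R => v i).
Proof.
move=> _ A mA; apply: sub_sigma_algebra.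
by exists i => //; exists A.
Qed.

Lemma measurable_fun_cyl d (T : measurableType d) (I : Type) (R : realType)
    (f : I -> T -> R) : (forall i, measurable_fun setT (f i)) ->
  measurable_fun setT (fun x => f^~ x : cylType I R).
Proof.
move=> mf; apply: (@measurability _ _ _ (cylType I R) _ _ (@proj_preimages I R)).
  by [].
move=> _ [_ [i _ [A mA <-]] <-].
by rewrite [X in _ @^-1` X]setTI; exact: mf.
Qed.

(** Sets with such a support form a sigma-algebra containing the generators: the condition is
    symmetric in [v] and [w], which gives complements, and countably many supports have a countable
    union. *)
Lemma cyl_set_countable_support (I : Type) (R : realType)
    (A : set (cylType I R)) : measurable A ->
  exists2 C : set I, countable C &
    forall v w : I -> R, (forall i, C i -> v i = w i) -> A v -> A w.
Proof.
move: A; apply: smallest_sub => /=; first split.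
- by exists set0.
- move=> A [C cC CA]; exists C => // v w vw [_ Av]; split => // Aw; apply: Av.
  by apply: CA Aw => i /vw.
- move=> A hA; pose C n := projT1 (cid2 (hA n)).
  exists (\bigcup_n C n).
    by apply: bigcup_countable => // n _; rewrite /C; case: cid2.
  move=> v w vw [n _ An]; exists n => //; move: An.
  have {}vw i : C n i -> v i = w i by move=> Ci; apply: vw; exists n.
  by move: vw; rewrite /C; case: cid2 => /= D _ + vw; apply.
- move=> _ [i _ [A mA <-]]; exists [set i]; first exact: countable1.
  by move=> v w vw [_ Av]; split => //=; rewrite -vw.
Qed.

(** Each sublevel set of [tau] at a rational has a countable support; two distinct values of [tau]
    are separated by a rational, so the union of these supports works. *)
Lemma cyl_fun_countable_support (I : Type) (R : realType)
    (tau : cylType I R -> R) : measurable_fun setT tau ->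
  exists2 C : set I, countable C &
    forall v w : I -> R, (forall i, C i -> v i = w i) -> tau v = tau w.
Proof.
move=> mtau.
have hA (q : rat) : exists2 C : set I, countable C &
    forall v w : I -> R, (forall i, C i -> v i = w i) ->
      tau v < ratr q -> tau w < ratr q.
  apply: (@cyl_set_countable_support _ _ (tau @^-1` `]-oo, (ratr q)[)).
  by rewrite -[_ @^-1` _]setTI; exact: mtau.
pose C q := projT1 (cid2 (hA q)).
have ltC v w : (forall i, (\bigcup_q C q) i -> v i = w i) -> ~ (tau v < tau w).
  move=> vw /rat_in_itvoo[q]; rewrite in_itv /= => /andP[vq qw].
  have {}vw i : C q i -> v i = w i by move=> Ci; apply: vw; exists q.
  move: vw; rewrite /C; case: cid2 => /= D _ + vw => /(_ v w vw vq).
  by rewrite ltNge (ltW qw).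
exists (\bigcup_q C q).
  by apply: bigcup_countable => // q _; rewrite /C; case: cid2.
move=> v w vw; apply/eqP; rewrite eq_le !leNgt.
by apply/andP; split; apply/negP; apply: ltC => // i /vw.
Qed.

Section weighted_counting.
Context {R : realType} (w : nat -> {nonneg R}).

Definition weighted_counting : {measure set nat -> \bar R} :=
  mseries (fun n => mscale (w n) (dirac n)) 0.

Lemma integral_weighted_counting (f : nat -> R) : (forall n, 0 <= f n) ->
  (\int[weighted_counting]_n (f n)%:E =
   \sum_(0 <= n <oo) ((w n)%:num * f n)%:E)%E.
Proof.
move=> f0; rewrite ge0_integral_measure_series//; last first.
  by move=> n _; rewrite lee_fin.
apply: eq_eseriesr => n _.
rewrite ge0_integral_mscale//; last by move=> ? _; rewrite lee_fin.
by rewrite integral_dirac// diracT mul1e EFinM.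
Qed.

End weighted_counting.

(** The first [N] terms have a finite sum, and the tail is dominated by the geometric series of sum
    1. *)
Lemma nneseries_lty_near (R : realType) (u : nat -> R) (N : nat) :
  (forall n, 0 <= u n) -> (forall n, (N <= n)%N -> u n <= 1 / (2 ^ n.+1)%:R) ->
  (\sum_(0 <= n <oo) (u n)%:E < +oo)%E.
Proof.
move=> u0 uN; rewrite (nneseries_split 0 N); last first.
  by move=> ? _; rewrite lee_fin.
rewrite add0n lte_add_pinfty//.
  by rewrite sumEFin ltry.
rewrite eseries_cond/=; apply: le_lt_trans (ltry 1).
apply: le_trans (epsilon_trick0 (fun n => N <= n)%N ler01).
apply: lee_nneseries => [n _ _|n Nn]; rewrite lee_fin//; exact: uN.
Qed.

Lemma nneseries_ge1_pinfty (R : realType) (u : nat -> R) :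
  (forall n, 1 <= u n) -> (\sum_(0 <= n <oo) (u n)%:E = +oo)%E.
Proof.
move=> u1; have u0 n : (0 <= (u n)%:E)%E by rewrite lee_fin (le_trans _ (u1 n)).
apply/eqyP => r r0.
(* The first [Num.bound r] terms already add up to more than [r]. *)
apply: le_trans (nneseries_lim_ge (Num.bound r) (fun n _ _ => u0 n)).
rewrite sumEFin lee_fin (le_trans (ltW (archi_boundP (ltW r0))))//.
rewrite -[X in X%:R]subn0 -[leLHS]sumr_const_nat.
by apply: ler_sum_nat => i _.
Qed.

Lemma finite_set_prefix (I : Type) (C : set I) (e : I -> nat) (n : nat) :
  {in C &, injective e} -> finite_set [set i | C i /\ (e i < n)%N].
Proof.
move=> inje; set D := [set i | _].
have eD : (e @` D #= D)%card.
  apply: inj_card_eq => i j /set_mem[Ci _] /set_mem[Cj _].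
  by apply: inje; exact: mem_set.
rewrite -(eq_finite_set eD); apply: sub_finite_set (finite_II n).
by move=> _ [i [_ ?] <-].
Qed.

Lemma preserves_integrability_measurable (R : realType) (I : Type)
    (tau : (I -> R) -> R) (p : R) : 1 <= p -> preserves_integrability tau p ->
  measurable_fun [set: cylType I R] (tau : cylType I R -> R).
Proof.
move=> p1 htau.
(* Applied to the family of all projections, [tau] gives back [tau] itself. *)
apply: ((Lfun_powR mzero _ p1).1 (htau _ (cylType I R) _ (fun i v => v i) _)).1.
move=> i; apply/(Lfun_powR _ _ p1); split; first exact: measurable_proj_cyl.
by rewrite integral_measure_zero.
Qed.

Lemma bounded_preserves_integrability (R : realType) (I : Type)
    (tau : cylType I R -> R) (p : R) (J : seq I) (lambda : I -> R) : 1 <= p ->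
  measurable_fun setT tau ->
  (forall v : I -> R, `|tau v| <= \sum_(j <- J) lambda j * `|v j|) ->
  preserves_integrability tau p.
Proof.
move=> p1 mtau tauJ d T mu f Lf; have p1E : (1 <= p%:E)%E by rewrite lee_fin.
have mf i : measurable_fun setT (f i) := ((Lfun_powR _ _ p1).1 (Lf i)).1.
have Lnf i : (fun x => `|f i x|) \in Lfun mu p%:E.
  have [_ If] := (Lfun_powR _ _ p1).1 (Lf i).
  apply/(Lfun_powR _ _ p1); split; first exact: measurableT_comp.
  by under eq_integral do rewrite normr_id.
pose g : T -> R := \sum_(j <- J) lambda j *: (fun x => `|f j x|).
have gE x : g x = \sum_(j <- J) lambda j * `|f j x|.
  by rewrite /g fct_sumE.
have Lg : g \in Lfun mu p%:E.
  have [L0 LD] := Lfun_addr_closed mu p1E.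
  apply: (big_ind (fun h => h \in Lfun mu p%:E)) => // j _.
  (* Closure under [a *: u + v], taken at [v = 0], gives scalar multiples. *)
  have [_ /(_ (lambda j) _ _ (Lnf j) L0)] := Lfun_submod_closed mu p1E.
  by rewrite addr0.
have [mg Ig] := (Lfun_powR _ _ p1).1 Lg.
have mtf : measurable_fun setT (fun x => tau (f^~ x)).
  exact: (measurableT_comp mtau (measurable_fun_cyl mf)).
have mpow (h : T -> R) : measurable_fun setT h ->
    measurable_fun setT (fun x => `|h x| `^ p).
  move=> mh; apply: (measurableT_comp (measurable_powR _)) => //.
  exact: measurableT_comp.
apply/(Lfun_powR _ _ p1); split => //.
apply: le_lt_trans Ig; apply: ge0_le_integral => //=.
- by apply/measurable_EFinP; exact: mpow.
- by apply/measurable_EFinP; exact: mpow.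
- move=> x _; rewrite lee_fin ge0_ler_powR ?nnegrE//.
    exact: le_trans p1.
  by rewrite (le_trans (tauJ _))// -gE ler_norm.
Qed.

Lemma preserves_integrability_bounded (R : realType) (I : Type)
    (tau : (I -> R) -> R) (p : R) : 1 <= p -> preserves_integrability tau p ->
  exists (J : {fset {classic I}}) (c : R), 0 <= c /\
    forall v : I -> R, `|tau v| <= \sum_(j <- J) c * `|v j|.
Proof.
move=> p1 htau; have p0 : p != 0 by rewrite gt_eqF// (lt_le_trans ltr01).
have [C /countable_injP[e inje] Ctau] := cyl_fun_countable_support
  (preserves_integrability_measurable p1 htau).
(* Coordinates in [C] with code below [n]: finite by injectivity of [e] on [C], increasing in [n],
   with union [C]. *)
pose J n : {fset {classic I}} :=
  fset_set ([set i | C i /\ (e i < n)%N] : set {classic I}).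
have JP n (i : {classic I}) : C i -> (e i < n)%N -> i \in J n.
  move=> Ci ein; rewrite /J in_fset_set; last exact: finite_set_prefix.
  exact: mem_set.
apply: contrapT => nbd.
have {nbd} /choice[v vP] n : exists v : I -> R,
    \sum_(j <- J n) (2 ^ n.+1)%:R * `|v j| < `|tau v|.
  apply: contrapT => nv; apply: nbd; exists (J n), (2 ^ n.+1)%:R.
  split=> // v; rewrite leNgt; apply/negP => vlt; apply: nv.
  by exists v.
have tau0 n : 0 < `|tau (v n)|.
  by apply: le_lt_trans (vP n); apply: sumr_ge0 => j _; rewrite mulr_ge0.
(* Only the term of index [i] is kept in the sum bounded by [vP n]; the others are nonnegative. *)
have vtau n i : C i -> (e i < n)%N ->
    `|v n i| / `|tau (v n)| <= 1 / (2 ^ n.+1)%:R.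
  move=> Ci ein; rewrite ler_pdivrMr// mulrC mul1r ler_pdivlMr; last first.
    by rewrite ltr0n expn_gt0.
  rewrite mulrC (le_trans _ (ltW (vP n)))//.
  rewrite (big_fsetD1 (i : {classic I}))/=; last exact: JP.
  by rewrite lerDl sumr_ge0// => j _; rewrite mulr_ge0.
(* This weight divides the integrand by [|tau (v n)|] inside the power, so [tau (v n)] contributes
   exactly 1 at each [n]. *)
pose w n : {nonneg R} := NngNum (powR_ge0 `|tau (v n)|^-1 p).
have wE n x : (w n)%:num * `|x| `^ p = (`|x| / `|tau (v n)|) `^ p.
  by rewrite /= -powRM ?invr_ge0// mulrC.
(* [vtau] controls only coordinates in [C]; the others are set to 0, which [tau] does not detect. *)
pose f i n : R := if i \in C then v n i else 0.
have Lf i : f i \in Lfun (weighted_counting w) p%:E.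
  apply/(Lfun_powR _ _ p1); split => //.
  rewrite integral_weighted_counting; last by move=> n; exact: powR_ge0.
  (* From [n = (e i).+1] on, a coordinate [i] of [C] lies in [J n]. *)
  apply: (@nneseries_lty_near _ _ (e i).+1) => [n|n ein].
    by rewrite mulr_ge0 ?powR_ge0.
  rewrite wE /f; case: ifPn => [/set_mem Ci|_]; last first.
    by rewrite normr0 mul0r powR0// divr_ge0.
  have := vtau n i Ci ein; set r := _ / `|tau _| => rn.
  have r0 : 0 <= r by rewrite divr_ge0.
  apply: le_trans (rn); move: r0; rewrite le_eqVlt => /predU1P[<-|r0].
    by rewrite powR0.
  rewrite ge1r_powR// r0/= (le_trans rn)// ler_pdivrMr ?ltr0n ?expn_gt0//.
  by rewrite mul1r ler1n expn_gt0.
have [_] := (Lfun_powR _ _ p1).1 (htau _ _ (weighted_counting w) f Lf).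
rewrite integral_weighted_counting; last by move=> n; exact: powR_ge0.
rewrite nneseries_ge1_pinfty// => n; rewrite wE.
rewrite (Ctau _ (v n)); last by move=> i Ci; rewrite /f mem_set.
by rewrite divff ?powR1// gt_eqF.
Qed.

Theorem theorem2p1 (R : realType) (I : Type) (tau : (I -> R) -> R) (p : R)
    (p1 : 1 <= p) :
  preserves_integrability tau p <->
  (measurable_fun [set: cylType I R] (tau : cylType I R -> R) /\
   exists (J : {fset {classic I}}) (lambda : I -> R),
     (forall j, j \in J -> 0 <= lambda j) /\
     (forall v : I -> R, `|tau v| <= \sum_(j <- J) lambda j * `|v j|)).
Proof.
split=> [htau|[mtau [J [lambda [_ tauJ]]]]].
  split; first exact: preserves_integrability_measurable htau.
  have [J [c [c0 tauJ]]] := preserves_integrability_bounded p1 htau.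
  by exists J, (fun=> c).
exact: bounded_preserves_integrability mtau tauJ.
Qed.
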